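(* Let $N\ge1$, $d\ge2$, let $\bm{p}=(p_1,\ldots,p_d)$ be a probability distribution with all $p_j>0$, and let $\bm{u}=\{u^{(l)}\}_{l=0}^{d-1}$ be real functions on $\{1,\ldots,d\}$ with $u^{(0)}\equiv1$ that are orthonormal on $\bm{p}$: $\sum_{i=1}^d u^{(l)}_iu^{(m)}_ip_i=\delta_{lm}$. Then for all $\bm{x}\in\mathbb{Z}_{\ge0}^d$ with $|\bm{x}|=N$, all $\bm{n}=(n_1,\ldots,n_{d-1})\in\mathbb{Z}_{\ge0}^{d-1}$ with $|\bm{n}|\le N$, and $i=0,1,\ldots,d-1$, $$n_iQ_{\bm{n}}(\bm{x};\bm{u})=\sum_{j,l=1}^dx_ju_j^{(i)}u_l^{(i)}p_l\,Q_{\bm{n}}(\bm{x}-\bm{e}_j+\bm{e}_l;\bm{u}),$$ where $n_0=N-|\bm{n}|$.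
   Context: $|\cdot|$ denotes the sum of entries of a vector and $\bm{e}_j$ the $j$th standard unit vector of $\mathbb{R}^d$. The multivariate Krawtchouk polynomial $Q_{\bm{n}}(\bm{x};\bm{u})$ is the coefficient of $w_1^{n_1}\cdots w_{d-1}^{n_{d-1}}$ in $$\prod_{j=1}^d\Big(1+\sum_{l=1}^{d-1}w_lu_j^{(l)}\Big)^{x_j}.$$ Terms on the right with $x_j=0$ are taken to be $0$. *)

(* Defs.v *)
(* MathComp, with multinomials for multivariate polynomials. *)
From HB Require Import structures.
From mathcomp Require Import all_boot all_order all_algebra.
From mathcomp Require Import mpoly.

Set Implicit Arguments.
Unset Strict Implicit.
Unset Printing Implicit Defensive.

Import Order.TTheory GRing.Theory Num.Theory.
Local Open Scope ring_scope.

(* The functions u^(0), ..., u^(d-1) are indexed by 'I_d.-1.+1 (for 0 < d), so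
   that [ord0] is the index 0 and [lift ord0 k] is the index k + 1. The
   variables w_1, ..., w_(d-1) are 'X_0, ..., 'X_(d-2): the indeterminate 'X_k
   is w_(k+1), and correspondingly [n k] is n_(k+1). *)

Definition kraw_gen (R : comNzRingType) (d : nat)
    (u : 'I_d.-1.+1 -> 'I_d -> R) (x : 'X_{1..d}) : {mpoly R[d.-1]} :=
  \prod_(j < d) (1 + \sum_(k < d.-1) u (lift ord0 k) j *: 'X_k) ^+ x j.

Definition krawQ (R : comNzRingType) (d : nat)
    (u : 'I_d.-1.+1 -> 'I_d -> R) (n : 'X_{1..d.-1}) (x : 'X_{1..d}) : R :=
  (kraw_gen u x)@_n.

Definition prob_distr (R : numDomainType) (d : nat) (p : 'I_d -> R) : Prop :=
  (forall j, 0 <= p j) /\ \sum_(j < d) p j = 1.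

Definition orthonormal_on (R : nzRingType) (d : nat) (p : 'I_d -> R)
    (u : 'I_d.-1.+1 -> 'I_d -> R) : Prop :=
  forall l m, \sum_(i < d) u l i * u m i * p i = (l == m)%:R.

(* n_0, n_1, ..., n_(d-1), where n_0 = N - |n| (meaningful when |n| <= N). *)
Definition ext_index (d N : nat) (n : 'X_{1..d.-1}) (i : 'I_d.-1.+1) : nat :=
  if unlift ord0 i is Some k then n k else (N - mdeg n)%N.

(* Main.v *)
(* The product [kraw_gen u x] is [prod_j L_j ^ x_j] with
   [L_j = sum_i u^(i)_j w_i] and [w_0 = 1].  By orthonormality
   [sum_l u^(i)_l p_l L_l = w_i], so the right-hand side is the coefficient of
   [w^n] in [w_i * sum_j x_j u^(i)_j prod_k L_k ^ (x - e_j)_k].  For [i > 0]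
   this polynomial is [w_i d/dw_i] applied to the generating function.  The
   polynomials for all [i] add up to [N] times the generating function, by
   Euler's identity for the homogenized product, which settles [i = 0]. *)
Require Import Defs.
From HB Require Import structures.
From mathcomp Require Import all_boot all_order all_algebra.
From mathcomp Require Import mpoly.

Set Implicit Arguments.
Unset Strict Implicit.
Unset Printing Implicit Defensive.

Import Order.TTheory GRing.Theory Num.Theory.
Local Open Scope ring_scope.

Lemma mderiv_exp (R : comNzRingType) (n : nat) (i : 'I_n)
    (q : {mpoly R[n]}) (k : nat) :
  (q ^+ k)^`M(i) = k%:R * q^`M(i) * q ^+ k.-1.
Proof.
elim: k => [|k IHk]; first by rewrite expr0 -mpolyC1 mderivC !mul0r.
rewrite exprS mderivM IHk -natr1 /= !mulrDl mul1r addrC; congr (_ + _).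
(* At [k = 0] the truncated exponent [k.-1] breaks [q * q ^+ k.-1 = q ^+ k], but the scalar [k%:R]
   vanishes. *)
case: k {IHk} => [|k]; first by rewrite !mul0r mulr0.
by rewrite /= mulrCA -exprS.
Qed.

Lemma mderiv_prod (R : comNzRingType) (n : nat) (i : 'I_n) (I : eqType)
    (s : seq I) (F : I -> {mpoly R[n]}) : uniq s ->
  (\prod_(j <- s) F j)^`M(i)
  = \sum_(j <- s) (F j)^`M(i) * \prod_(k <- s | k != j) F k.
Proof.
elim: s => [|a s IHs] /=; first by rewrite !big_nil -mpolyC1 mderivC.
case/andP=> nas us; rewrite !big_cons eqxx /= mderivM IHs //; congr (_ * _ + _).
  (* Since [a] does not occur in [s], the filter [k != a] removes nothing. *)
  rewrite big_seq [RHS]big_seq_cond; apply: eq_bigl => k.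
  by have [->|] := eqVneq k a; rewrite ?andbT // (negbTE nas).
rewrite mulr_sumr; apply: eq_big_seq => j js.
have naj : a != j by apply: contraNneq nas => ->.
by rewrite big_cons naj mulrCA.
Qed.

(** Each monomial is an eigenvector of [w_i d/dw_i], with its exponent in [w_i] as eigenvalue. *)
Lemma mcoeff_euler (R : comNzRingType) (n : nat) (i : 'I_n)
    (q : {mpoly R[n]}) (m : 'X_{1..n}) :
  ('X_i * q^`M(i))@_m = (m i)%:R * q@_m.
Proof.
rewrite [q]mpolyE !raddf_sum /= mulr_sumr !raddf_sum mulr_sumr.
apply: eq_bigr => k _.
rewrite mderivZ mderivX scalerA -scalerAr -mpolyXD /= !mcoeffZ !mcoeffX.
have [k0|ki] := eqVneq (k i) 0%N.
  rewrite k0 mulr0 mul0r.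
  by have [<-|_] := eqVneq k m; rewrite ?k0 ?mul0r ?mulr0.
rewrite addmC submK ?lep1mP //.
by have [->|_] := eqVneq k m; rewrite ?mulr1 ?mulr0 // mulrC.
Qed.

Section GeneratingFunction.
Variables (R : comNzRingType) (d : nat) (u : 'I_d.-1.+1 -> 'I_d -> R).

Definition kraw_var (i : 'I_d.-1.+1) : {mpoly R[d.-1]} :=
  if unlift ord0 i is Some k then 'X_k else 1.

Definition kraw_factor (j : 'I_d) : {mpoly R[d.-1]} :=
  1 + \sum_(k < d.-1) u (lift ord0 k) j *: 'X_k.

(** With [u ord0] constantly 1, this is the [w_i]-derivative of the homogenized product at
    [w_0 = 1]. Where [x j = 0] the subtraction truncates, but the coefficient is zero. *)
Definition kraw_shift (x : 'X_{1..d}) (i : 'I_d.-1.+1) : {mpoly R[d.-1]} :=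
  \sum_(j < d) ((x j)%:R * u i j) *: kraw_gen u (x - U_(j))%MM.

Lemma kraw_factorE j : u ord0 j = 1 ->
  kraw_factor j = \sum_i u i j *: kraw_var i.
Proof.
move=> u0; rewrite big_ord_recl u0 /kraw_var unlift_none scale1r.
by congr (_ + _); apply: eq_bigr => k _; rewrite liftK.
Qed.

Lemma kraw_genD1 x j :
  kraw_gen u (x + U_(j))%MM = kraw_factor j * kraw_gen u x.
Proof.
rewrite /kraw_gen (bigD1 j) //= [in RHS](bigD1 j) //= mnmDE mnm1E eqxx addn1.
rewrite exprS -mulrA; congr (_ * (_ * _)).
by apply: eq_bigr => k kj; rewrite mnmDE mnm1E eq_sym (negbTE kj) addn0.
Qed.

Lemma kraw_gen_subD1 (x : 'X_{1..d}) j :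
  (x j)%:R *: (kraw_factor j * kraw_gen u (x - U_(j))%MM)
  = (x j)%:R *: kraw_gen u x.
Proof.
have [->|xj] := eqVneq (x j) 0%N; first by rewrite !scale0r.
by rewrite -kraw_genD1 submK // lep1mP.
Qed.

Lemma mderiv_kraw_factor j k :
  (kraw_factor j)^`M(k) = (u (lift ord0 k) j)%:MP.
Proof.
rewrite /kraw_factor mderivD -mpolyC1 mderivC add0r raddf_sum (bigD1 k) //=.
rewrite mderivZ mderivX mnm1E eqxx scale1r -[X in (X - _)%MM]add0m addmK.
rewrite mpolyX0 alg_mpolyC big1 ?addr0 // => l lk.
by rewrite mderivZ mderivX mnm1E (negbTE lk) scale0r scaler0.
Qed.

Lemma mderiv_kraw_gen x k :
  (kraw_gen u x)^`M(k) = kraw_shift x (lift ord0 k).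
Proof.
rewrite /kraw_gen mderiv_prod ?index_enum_uniq //; apply: eq_bigr => j _.
rewrite mderiv_exp -/(kraw_factor j) mderiv_kraw_factor.
rewrite -mpolyCMn -mpolyCM /= -mulrA mul_mpolyC; congr (_ *: _).
rewrite [RHS](bigD1 j) //= mnmBE mnm1E eqxx subn1; congr (_ * _).
by apply: eq_bigr => l lj; rewrite mnmBE mnm1E eq_sym (negbTE lj) subn0.
Qed.

(** After exchanging sums, the sum over [i] rebuilds [kraw_factor j], which restores the factor
    removed by [x - U_(j)]; each [j] then contributes [x j] copies of the product. *)
Lemma kraw_shift_euler x : (forall j, u ord0 j = 1) ->
  \sum_i kraw_var i * kraw_shift x i = (mdeg x)%:R *: kraw_gen u x.
Proof.
move=> u0; under eq_bigr do rewrite mulr_sumr.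
rewrite exchange_big mdegE natr_sum scaler_suml; apply: eq_bigr => j _ /=.
rewrite -kraw_gen_subD1 kraw_factorE // mulr_suml scaler_sumr.
by apply: eq_bigr => i _; rewrite -scalerAr -scalerAl scalerA.
Qed.

Lemma mcoeff_kraw_shift x n i : (forall j, u ord0 j = 1) ->
    (mdeg n <= mdeg x)%N ->
  (kraw_var i * kraw_shift x i)@_n = (ext_index (mdeg x) n i)%:R * krawQ u n x.
Proof.
move=> u0 le_nx.
have lifted k : (kraw_var (lift ord0 k) * kraw_shift x (lift ord0 k))@_n
    = (n k)%:R * krawQ u n x.
  by rewrite -mderiv_kraw_gen /kraw_var liftK mcoeff_euler.
rewrite /ext_index; case: unliftP => [k|] ->; first exact: lifted.
(* For [i = 0], subtract the contributions of the lifted indices, which total [mdeg n], from Euler's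
   identity; [le_nx] makes the natural subtraction exact. *)
have /(congr1 (mcoeff n)) := kraw_shift_euler x u0.
rewrite big_ord_recl mcoeffD mcoeffZ raddf_sum /=.
under eq_bigr do rewrite lifted.
rewrite -mulr_suml -natr_sum -mdegE natrB // mulrBl => <-.
by rewrite addrK.
Qed.

Lemma sum_kraw_factor (p : 'I_d -> R) i : (forall j, u ord0 j = 1) ->
  orthonormal_on p u -> \sum_l (u i l * p l) *: kraw_factor l = kraw_var i.
Proof.
move=> u0 hu; under eq_bigr do rewrite kraw_factorE // scaler_sumr.
(* The coefficient of [kraw_var m] is now the inner product of [u i] and [u m] on [p]. *)
rewrite exchange_big (bigD1 i) //= [X in _ + X]big1 ?addr0 => [|m mi].
all: under eq_bigr do rewrite scalerA mulrAC.
all: by rewrite -scaler_suml hu ?eqxx ?scale1r // eq_sym (negbTE mi) scale0r.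
Qed.

End GeneratingFunction.

Theorem theorem7 (R : realFieldType) (N d : nat) (hN : (1 <= N)%N)
    (hd : (2 <= d)%N) (p : 'I_d -> R) (hp : prob_distr p)
    (hp0 : forall j : 'I_d, 0 < p j)
    (u : 'I_d.-1.+1 -> 'I_d -> R) (hu0 : forall j : 'I_d, u ord0 j = 1)
    (hu : orthonormal_on p u)
    (x : 'X_{1..d}) (hx : mdeg x = N)
    (n : 'X_{1..d.-1}) (hn : (mdeg n <= N)%N) (i : 'I_d.-1.+1) :
  (ext_index N n i)%:R * krawQ u n x =
  \sum_(j < d | (0 < x j)%N) \sum_(l < d)
    (x j)%:R * u i j * u i l * p l * krawQ u n (x - U_(j) + U_(l))%MM.
Proof.
(* Expanding [kraw_var i] over the [kraw_factor l] supplies the index [l] of the right-hand side. *)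
rewrite -hx in hn *; rewrite -mcoeff_kraw_shift // -(sum_kraw_factor _ hu0 hu).
rewrite [RHS]big_mkcond mulr_sumr raddf_sum; apply: eq_bigr => j _ /=.
have [xj|] := ltnP 0 (x j); last first.
  by rewrite leqn0 => /eqP->; rewrite mul0r scale0r mulr0 mcoeff0.
rewrite mulr_suml raddf_sum; apply: eq_bigr => l _ /=.
(* Multiplying by [kraw_factor l] is the shift by [U_(l)]. *)
rewrite /krawQ kraw_genD1 -scalerAr -scalerAl scalerA mcoeffZ; congr (_ * _).
by rewrite !mulrA.
Qed.
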